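(* Fix $n\in S$, and let $T_n:=\mathrm{Re}(\Theta_n)$ and $\widehat{T}_n:=\mathrm{Im}(\Theta_n)$ be the real and imaginary parts of the complex arithmetic random wave $\Theta_n$. Then $T_n$ and $\widehat{T}_n$ are two real-valued independent centered Gaussian fields such that, for all $x,y\in\mathbb{T}$, $$\mathbb{E}[T_n(x)T_n(y)]=\mathbb{E}[\widehat{T}_n(x)\widehat{T}_n(y)]=\frac{1}{\mathcal{N}_n}\sum_{\lambda\in\Lambda_n}\cos(2\pi\langle\lambda,x-y\rangle).$$ Also, there exist two collections of complex random variables $\mathbf{A}(n)=\{a_\lambda:\lambda\in\Lambda_n\}$ and $\widehat{\mathbf{A}}(n)=\{\widehat{a}_\lambda:\lambda\in\Lambda_n\}$ with the following properties: (i) $\mathbf{A}(n)$ and $\widehat{\mathbf{A}}(n)$ are stochastically independent and identically distributed as random vectors indexed by $\Lambda_n$; (ii) for every $\lambda\in\Lambda_n$, $a_\lambda$ is a complex-valued Gaussian random variable whose real and imaginary parts are independent Gaussian random variables with mean zero and variance $1/2$; (iii) if $\lambda\notin\{\sigma,-\sigma\}$ (with $\lambda,\sigma\in\Lambda_n$), then $a_\lambda$ and $a_\sigma$ are stochastically independent; (iv) $a_\lambda=\overline{a_{-\lambda}}$ for every $\lambda\in\Lambda_n$; (v) for every $x\in\mathbb{T}$, $$T_n(x)=\frac{1}{\sqrt{\mathcal{N}_n}}\sum_{\lambda\in\Lambda_n}a_\lambda e_\lambda(x)\quad\text{and}\quad\widehat{T}_n(x)=\frac{1}{\sqrt{\mathcal{N}_n}}\sum_{\lambda\in\Lambda_n}\widehat{a}_\lambda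 e_\lambda(x).$$
   Context: $\mathbb{T}=\mathbb{R}^2/\mathbb{Z}^2$ is the flat torus. $S$ is the set of positive integers $n$ that can be written as $n=a^2+b^2$ with $a,b\in\mathbb{Z}$. For $n\in S$: $\Lambda_n:=\{\lambda\in\mathbb{Z}^2:\|\lambda\|^2=n\}$, $\mathcal{N}_n:=|\Lambda_n|$, $e_\lambda(x):=e^{2\pi i\langle\lambda,x\rangle}$. The complex arithmetic random wave of order $n$ is $$\Theta_n(x):=\frac{1}{\sqrt{\mathcal{N}_n}}\sum_{\lambda\in\Lambda_n}v_\lambda e_\lambda(x),\quad x\in\mathbb{T},$$ where the $v_\lambda$, $\lambda\in\Lambda_n$, are i.i.d. complex Gaussian random variables such that $\mathrm{Re}(v_\lambda)$ and $\mathrm{Im}(v_\lambda)$ are independent real centered Gaussian random variables with variance one. *)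

(* Defs.v *)
From HB Require Import structures.
From mathcomp Require Export all_boot all_order all_algebra.
From mathcomp Require Export finmap generic_quotient ring_quotient complex.
From mathcomp Require Export all_classical all_reals all_analysis.
From mathcomp Require Import zify ring lra.

Set Implicit Arguments.
Unset Strict Implicit.
Unset Printing Implicit Defensive.

Import Order.TTheory GRing.Theory Num.Theory.

Local Open Scope classical_set_scope.
Local Open Scope ring_scope.

(* The Borel sigma-algebra on R[i], identified with R * R. *)
Definition complex_display : measure_display.
Proof. exact: default_measure_display. Qed.

Section complex_measurable.
Variable R : realType.

HB.instance Definition _ := isPointed.Build R[i] 0.

Let C_measurable : set_system R[i] :=
  g_sigma_preimageU (@complex.Re R) (@complex.Im R).

Let C_measurable0 : C_measurable set0.
Proof. exact: sigma_algebra0. Qed.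

Let C_measurableC A : C_measurable A -> C_measurable (~` A).
Proof. exact: sigma_algebraC. Qed.

Let C_measurable_bigcup (F : (set R[i])^nat) :
  (forall i, C_measurable (F i)) -> C_measurable (\bigcup_i F i).
Proof. exact: sigma_algebra_bigcup. Qed.

HB.instance Definition _ := @isMeasurable.Build complex_display R[i]
  C_measurable C_measurable0 C_measurableC C_measurable_bigcup.

End complex_measurable.

Definition sigma_family {d'} (aT I : Type) (E : measurableType d')
    (X : I -> aT -> E) : set_system aT :=
  <<s \bigcup_i preimage_set_system setT (X i) measurable >>.

Section probability_notions.
Context {d} {Omega : measurableType d} {R : realType}.
Variable P : probability Omega R.

Definition indep_systems (F G : set_system Omega) : Prop :=
  forall A B, F A -> G B -> P (A `&` B) = (P A * P B)%E.

Definition indep_rv {d1 d2} {E1 : measurableType d1} {E2 : measurableType d2}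
    (X : Omega -> E1) (Y : Omega -> E2) : Prop :=
  indep_systems (preimage_set_system setT X measurable)
                (preimage_set_system setT Y measurable).

Definition indep_families {d1 d2} {E1 : measurableType d1}
    {E2 : measurableType d2} {I J : Type}
    (X : I -> Omega -> E1) (Y : J -> Omega -> E2) : Prop :=
  indep_systems (sigma_family X) (sigma_family Y).

Definition mutually_indep {d1} {E : measurableType d1} {I : finType}
    (X : I -> Omega -> E) : Prop :=
  forall (J : {set I}) (A : I -> set E), (forall i, measurable (A i)) ->
    P (\bigcap_(i in [set` J]) (X i @^-1` A i)) =
      (\prod_(i in J) P (X i @^-1` A i))%E.

Definition same_law {d1} {E : measurableType d1} (X Y : Omega -> E) : Prop :=
  forall A, measurable A -> P (X @^-1` A) = P (Y @^-1` A).

(* Equality of laws on the product sigma-algebra of I -> E, i.e. the one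
   generated by the evaluations. *)
Definition same_joint_law {d1} {E : measurableType d1} {I : Type}
    (X Y : I -> Omega -> E) : Prop :=
  forall A : set (I -> E), sigma_family (fun i (f : I -> E) => f i) A ->
    P [set w | A (X ^~ w)] = P [set w | A (Y ^~ w)].

(* s2 is the variance. The case s2 = 0 is separate because [normal_prob m 0]
   is not the Dirac mass at m. *)
Definition gaussian_rv (X : Omega -> R) (m s2 : R) : Prop :=
  [/\ measurable_fun setT X, 0 <= s2 &
    forall A, measurable A -> P (X @^-1` A) =
      if s2 == 0 then \d_m A else normal_prob m (Num.sqrt s2) A].

Definition gaussian_field {I : Type} (X : I -> Omega -> R) : Prop :=
  forall (k : nat) (x : 'I_k -> I) (t : 'I_k -> R),
    exists m s2, gaussian_rv (fun w => \sum_(j < k) t j * X (x j) w) m s2.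

Definition centered_gaussian_field {I : Type} (X : I -> Omega -> R) : Prop :=
  gaussian_field X /\ forall i, ('E_P[X i] = 0)%E.

(* s2 is the common variance of the real and imaginary parts. *)
Definition complex_gaussian_rv (Z : Omega -> R[i]) (s2 : R) : Prop :=
  [/\ measurable_fun setT Z,
      gaussian_rv (fun w => complex.Re (Z w)) 0 s2,
      gaussian_rv (fun w => complex.Im (Z w)) 0 s2 &
      indep_rv (fun w => complex.Re (Z w)) (fun w => complex.Im (Z w))].

End probability_notions.

Definition sum_two_squares (n : nat) : Prop :=
  (0 < n)%N /\ exists a b : int, n%:Z = a ^+ 2 + b ^+ 2.

Definition Lambda_set (n : nat) : set (int * int) :=
  [set l | l.1 ^+ 2 + l.2 ^+ 2 = n%:Z].

Lemma finite_Lambda_set n : finite_set (Lambda_set n).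
Proof.
pose s : seq int := [seq i%:Z - n%:Z | i <- iota 0 n.*2.+1].
apply: (@sub_finite_set _ _ [set` allpairs pair s s]); last exact: finite_seq.
move=> [a b] nab.
have memS (c e : int) : c ^+ 2 + e ^+ 2 = n%:Z -> c \in s.
  rewrite !expr2 => nce; apply/mapP; exists (absz (c + n%:Z)).
    by rewrite mem_iota; nia.
  by nia.
rewrite -[_ (a, b)]/(is_true ((a, b) \in _)).
apply/allpairsP; exists (a, b); split => //=; first exact: memS nab.
by apply: (memS b a); rewrite addrC.
Qed.

Definition Lambda (n : nat) : {fset int * int} := fset_set (Lambda_set n).

Lemma in_Lambda n (l : int * int) :
  (l \in Lambda n) = (l.1 ^+ 2 + l.2 ^+ 2 == n%:Z).
Proof.
rewrite in_fset_set; last exact: finite_Lambda_set.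
by apply/idP/eqP => [/set_mem//|nl]; apply/mem_set.
Qed.

Lemma LambdaN n (l : Lambda n) : - fsval l \in Lambda n.
Proof. by rewrite in_Lambda /= !sqrrN -in_Lambda fsvalP. Qed.

Definition Lambda_opp n (l : Lambda n) : Lambda n := [` LambdaN l]%fset.

Section torus.
Variable R : realType.

Definition lattice : {pred R * R} :=
  fun z => (z.1 \is a Num.int) && (z.2 \is a Num.int).

Fact lattice_zmod_closed : zmod_closed lattice.
Proof.
split=> [|x y]; first by apply/andP; split; exact: rpred0.
by move=> /andP[? ?] /andP[? ?]; apply/andP; split; exact: rpredB.
Qed.

HB.instance Definition _ :=
  GRing.isZmodClosed.Build (R * R)%type lattice lattice_zmod_closed.

Definition torus := Quotient.quot lattice.
HB.instance Definition _ := GRing.Zmodule.on torus.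

Definition inner (l : int * int) (z : R * R) : R :=
  l.1%:~R * z.1 + l.2%:~R * z.2.

Definition expi (t : R) : R[i] := (cos t +i* sin t)%C.

(* [repr x] is a representative of x in R * R; by the lemmas [torus_cosE] and
   [torus_eE] the choice is immaterial. *)
Definition torus_cos (l : int * int) (x : torus) : R :=
  cos (2 * pi * inner l (repr x)).

Definition torus_e (l : int * int) (x : torus) : R[i] :=
  expi (2 * pi * inner l (repr x)).

Lemma expiD2piz t (k : int) : expi (t + 2 * pi * k%:~R) = expi t.
Proof.
have per m u : expi (u + 2 * pi * m%:R) = expi u.
  rewrite (_ : 2 * pi * m%:R = (pi *+ 2) *+ m); last first.
    by rewrite -[in RHS]mulr_natr -[pi *+ 2]mulr_natl.
  by rewrite /expi (periodicn (@cosD2pi R)) (periodicn (@sinD2pi R)).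
case: k => m; first exact: per.
by rewrite -[LHS](per m.+1) NegzE mulrNz mulrN -pmulrn subrK.
Qed.

Lemma expi_innerD l (z k : R * R) : k \in lattice ->
  expi (2 * pi * inner l (z + k)) = expi (2 * pi * inner l z).
Proof.
case: k => _ _ /andP[/= /intrP[a ->] /intrP[b ->]].
rewrite -[RHS](expiD2piz _ (l.1 * a + l.2 * b)); congr expi.
by rewrite /inner /= rmorphD /= !rmorphM /=; ring.
Qed.

Lemma torus_eE l (z : R * R) :
  torus_e l (\pi_torus z)%qT = expi (2 * pi * inner l z).
Proof.
rewrite /torus_e -(subrK z (repr (\pi_torus z)%qT)) addrC expi_innerD//.
by rewrite Quotient.idealrBE reprK.
Qed.

Lemma torus_cosE l (z : R * R) :
  torus_cos l (\pi_torus z)%qT = cos (2 * pi * inner l z).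
Proof. by have /(congr1 (@complex.Re R)) := torus_eE l z. Qed.

End torus.

Section random_wave.
Context {d} {Omega : measurableType d} {R : realType}.

Definition wave n (c : Lambda n -> Omega -> R[i]) (x : torus R) (w : Omega) :
    R[i] :=
  ((Num.sqrt (#|` Lambda n|%:R))^-1)%:C%C *
    \sum_(l : Lambda n) c l w * torus_e (fsval l) x.

Definition iid_standard_complex_gaussian (P : probability Omega R) n
    (v : Lambda n -> Omega -> R[i]) : Prop :=
  [/\ mutually_indep P v,
      forall l m, same_law P (v l) (v m) &
      forall l, complex_gaussian_rv P (v l) 1].

End random_wave.

(* Main.v *)
From HB Require Import structures.
Require Import Defs.
From mathcomp Require Import measurable_realfun gauss_integral.
From mathcomp Require Import zify ring lra.

Set Implicit Arguments.
Unset Strict Implicit.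
Unset Printing Implicit Defensive.

Import Order.TTheory GRing.Theory Num.Theory.
Import numFieldNormedType.Exports.

Local Open Scope classical_set_scope.
Local Open Scope ring_scope.

(** Write v_l = xi_l + i eta_l and N for the number of points of Lambda n. The
    2N variables xi_l, eta_l, indexed by Lambda n * bool, are independent standard normal variables
    ([iid_normal_component]), and everything in the statement is a real linear
    expression in them. So the proof rests on one fact, the rotation
    invariance of the planar Gaussian law: if X and Y are independent standard
    normal and c^2 + s^2 = 1, then so are cX + sY and -sX + cY. It follows from
    the rotation invariance of Lebesgue measure, obtained by writing a rotation
    as a product of three shears ([lebesgue2_rot], [prod_normal_rot]). Applied
    inside a larger independent family, it says that replacing two members by
    their rotated pair again gives independent standard normal variables
    ([iid_normal_rotate]). This is used in two ways.

    Iterating it so as to collect more and more terms into one member of the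
    family shows that every linear combination sum_k c_k g_k is r Z with Z
    standard normal and r^2 = sum_k c_k^2 ([iid_normal_lincomb]). Hence such
    combinations are centered Gaussian, and the covariance of two of them is
    the dot product of their coefficients, by polarization of the second
    moment ([lincomb_cov]). For the wave this dot product is
    N^-1 sum_l (cos cos + sin sin), which the addition formula turns into the
    stated covariance.

    Iterating it by an angle of pi/4 over the pairs l, -l shows that the
    variables (xi_l + xi_-l)/sqrt 2, (xi_l - xi_-l)/sqrt 2 and their analogues
    for eta, with l in a half system of representatives, are again independent
    standard normal ([iid_normal_symmetrized]). Put
    a_l = (v_l + conj v_-l)/2 ([hermitian_coef]). Then
    sum_l a_l e_l = Re (sum_l v_l e_l), and a depends only on the even parts of
    xi and the odd parts of eta, while the same construction applied to -i v
    gives ahat, hence Im of the wave, and depends only on the complementary half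
    of the new variables. Disjoint groups of independent variables generate
    independent sigma-algebras ([indep_cylinder]), so a and ahat, and with them
    T and That, are independent. They have the same law because the components
    of v and of -i v are both independent standard normal families, and such a
    family has only one possible joint law ([iid_normal_same_joint_law]). *)

(** * Rotation invariance of planar Lebesgue measure *)

Lemma measurable_preimageT d1 d2 (T1 : measurableType d1) (T2 : measurableType d2)
    (f : T1 -> T2) A :
  measurable_fun setT f -> measurable A -> measurable (f @^-1` A).
Proof. by move=> mf mA; rewrite -[X in measurable X]setTI; exact: mf. Qed.

Section affine.
Context {R : realType}.
Local Notation mu := (@lebesgue_measure R).

Lemma measurable_affine (a b : R) : measurable_fun setT (fun x : R => a * x + b).
Proof. by apply: measurable_funD => //; exact: measurable_funM. Qed.

Lemma lebesgue_affine (a b : R) (A : set R) : 0 < a -> measurable A ->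
  (mu A = a%:E * mu ((fun x => (a * x + b)%R) @^-1` A))%E.
Proof.
move=> a0 mA.
pose f := fun x : R => a * x + b.
pose m := mscale (NngNum (ltW a0)) (pushforward mu (f : _ -> measurableTypeR R)).
suff mE X : ocitv X -> mu X = m (measurable_affine a b) X by exact: (lebesgue_measure_unique mE mA).
move=> [[c e]] _ <-; rewrite /m.
rewrite /mscale /= /pushforward.
have -> : f @^-1` `]c, e]%classic = `](c - b) / a, (e - b) / a]%classic.
  apply/seteqP; split => x /=; rewrite !in_itv /= /f ltr_pdivrMr// ler_pdivlMr//;
  by rewrite [x * a]mulrC ltrBlDr lerBrDr.
rewrite !lebesgue_measure_itv/= !lte_fin ltr_pM2r ?invr_gt0// ltrD2r.
case: ifP => _; rewrite ?mule0// -!EFinD -EFinM; congr EFin.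
by field; rewrite gt_eqF.
Qed.

Lemma lebesgue_translation (b : R) (A : set R) : measurable A ->
  mu ((fun x => x + b) @^-1` A) = mu A.
Proof.
move=> mA; rewrite (lebesgue_affine b ltr01 mA) mul1e; congr (mu _).
by apply/seteqP; split => x /=; rewrite mul1r.
Qed.

Local Notation mu2 := (mu \x mu)%E.

Lemma lebesgue2_shear_right (b : R) (A : set (R * R)) : measurable A ->
  mu2 ((fun z => (z.1, z.2 + b * z.1)) @^-1` A) = mu2 A.
Proof.
move=> mA; rewrite /product_measure1/=; apply: eq_integral => x _ /=.
rewrite -[RHS](lebesgue_translation (b * x)); last exact: measurable_xsection.
by congr (mu _); apply/seteqP; split => y /=; rewrite /xsection /= !inE.
Qed.

Lemma lebesgue2_shear_left (b : R) (A : set (R * R)) : measurable A ->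
  mu2 ((fun z => (z.1 + b * z.2, z.2)) @^-1` A) = mu2 A.
Proof.
have mf : measurable_fun setT (fun z : R * R => (z.1 + b * z.2, z.2)).
  apply/measurable_fun_pair => //; apply: measurable_funD => //.
  exact: measurable_funM.
have mu12 B : measurable B -> mu2 B = (mu \x^ mu)%E B.
  move=> mB; apply: product_measure_unique => // C D mC mD.
  exact: product_measure2E.
move=> mA; rewrite !mu12//; last exact: measurable_preimageT.
rewrite /product_measure2/=; apply: eq_integral => y _ /=.
rewrite -[RHS](lebesgue_translation (b * y)); last exact: measurable_ysection.
by congr (mu _); apply/seteqP; split => x /=; rewrite /ysection /= !inE.
Qed.

Definition rot (c s : R) (z : R * R) : R * R :=
  (c * z.1 + s * z.2, - s * z.1 + c * z.2).

Lemma measurable_rot c s : measurable_fun setT (rot c s).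
Proof.
by apply/measurable_fun_pair; apply: measurable_funD; exact: measurable_funM.
Qed.

(** A rotation is the product of three shears, and a shear preserves the measure
    because on each line it is a translation. The shear coefficient
    (1 - c) / s is the tangent of half the angle, whence [s != 0]. *)
Lemma lebesgue2_rot (c s : R) (A : set (R * R)) :
  c ^+ 2 + s ^+ 2 = 1 -> s != 0 -> measurable A ->
  mu2 (rot c s @^-1` A) = mu2 A.
Proof.
move=> cs s0 mA; have s2 : s ^+ 2 = 1 - c ^+ 2 by rewrite -cs; ring.
pose a := (1 - c) / s.
pose L b := fun z : R * R => (z.1 + b * z.2, z.2).
pose U b := fun z : R * R => (z.1, z.2 + b * z.1).
have mL b : measurable_fun setT (L b).
  apply/measurable_fun_pair => //; apply: measurable_funD => //.
  exact: measurable_funM.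
have mU b : measurable_fun setT (U b).
  apply/measurable_fun_pair => //; apply: measurable_funD => //.
  exact: measurable_funM.
have -> : rot c s @^-1` A = L a @^-1` (U (- s) @^-1` (L a @^-1` A)).
  apply/seteqP; suff E z : rot c s z = L a (U (- s) (L a z)).
    by split => z /=; rewrite E.
  case: z => x y; rewrite /rot /L /U /=; congr (_, _); rewrite /a.
    rewrite [s * y](_ : _ = y * ((1 - c ^+ 2) / s)); last first.
      by rewrite -s2; field.
    by field.
  by field.
rewrite lebesgue2_shear_left; last by do 2 apply: measurable_preimageT => //.
rewrite lebesgue2_shear_right; last exact: measurable_preimageT.
exact: lebesgue2_shear_left.
Qed.

End affine.

(** * The standard normal law *)

Section density.
Context d (T : measurableType d) (R : realType).
Variables (m nu : {measure set T -> \bar R}) (g : T -> R).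
Hypotheses (mg : measurable_fun setT g) (g0 : forall x, 0 <= g x).
Hypothesis nuE : forall A, measurable A -> nu A = (\int[m]_(x in A) (g x)%:E)%E.
Local Open Scope ereal_scope.
Import HBNNSimple.

Let integral_density_nnsfun (h : {nnsfun T >-> R}) :
  \int[nu]_x (h x)%:E = \int[m]_x ((h x)%:E * (g x)%:E).
Proof.
under [LHS]eq_integral do rewrite fimfunE -fsumEFin//.
under [RHS]eq_integral.
  move=> x _; rewrite fimfunE -fsumEFin// ge0_mule_fsuml; last first.
    by move=> r; rewrite EFinM nnfun_muleindic_ge0.
  over.
rewrite [LHS]ge0_integral_fsum//; last 2 first.
- by move=> r; exact/measurable_EFinP/measurableT_comp.
- by move=> r x _; rewrite EFinM nnfun_muleindic_ge0.
rewrite [RHS]ge0_integral_fsum//; last 2 first.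
- move=> r; apply: emeasurable_funM; last exact/measurable_EFinP.
  exact/measurable_EFinP/measurableT_comp.
- by move=> r x _; rewrite mule_ge0 ?lee_fin// -lee_fin EFinM nnfun_muleindic_ge0.
apply: eq_fsbigr => r; rewrite inE => -[x _ hr].
have mr : measurable (h @^-1` [set r]) by [].
rewrite integralZl_indic_nnsfun// integral_indic// setIT nuE// integral_mkcond.
rewrite -ge0_integralZl_EFin//; last 3 first.
- by move=> y _; rewrite erestrict_ge0// => z _; rewrite lee_fin.
- by apply/(measurable_restrictT _ _).1 => //; exact/measurable_funTS/measurable_EFinP.
- by rewrite -hr.
apply: eq_integral => y _; rewrite /patch indicE.
by case: ifPn => _; rewrite ?mulr1// mulr0 mule0 mul0e.
Qed.

(** Both sides agree on simple functions, where they are finite sums of measures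
    of level sets; monotone convergence does the rest. *)
Lemma ge0_integral_density (f : T -> \bar R) :
  measurable_fun setT f -> (forall x, 0 <= f x) ->
  \int[nu]_x f x = \int[m]_x (f x * (g x)%:E).
Proof.
move=> mf f0; pose f_ := nnsfun_approx measurableT mf.
transitivity (limn (fun n => \int[nu]_x (f_ n x)%:E)).
  rewrite -monotone_convergence//.
  - apply: eq_integral => y _; apply/esym/cvg_lim => //.
    by apply: cvg_nnsfun_approx.
  - by move=> n; exact/measurable_EFinP/measurable_funP.
  - by move=> n y _; rewrite lee_fin.
  - by move=> y _ a b ab; rewrite lee_fin; exact/lefP/nd_nnsfun_approx.
under eq_fun do rewrite integral_density_nnsfun.
rewrite -monotone_convergence//.
- apply: eq_integral => y _; apply/cvg_lim => //.
  by apply: cvgeMr => //; apply: cvg_nnsfun_approx.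
- move=> n; apply: emeasurable_funM; first exact/measurable_EFinP/measurable_funP.
  exact/measurable_EFinP.
- by move=> n y _; rewrite mule_ge0 ?lee_fin.
- move=> y _ a b ab; rewrite lee_wpmul2r ?lee_fin//.
  exact/lefP/nd_nnsfun_approx.
Qed.

End density.

Section normal.
Context {R : realType}.
Local Notation mu := (@lebesgue_measure R).
Local Notation mu2 := (mu \x mu)%E.
Local Notation N := (@normal_prob R 0 1).
Local Notation phi := (@normal_pdf R 0 1).

Lemma std_normal_pdfE x : phi x = normal_peak 1 * expR (- (x ^+ 2) / 2).
Proof. by rewrite normal_pdfE ?oner_neq0// /normal_fun subr0 expr1n. Qed.

Lemma std_normal_pdfM x y :
  phi x * phi y = normal_peak 1 ^+ 2 * expR (- (x ^+ 2 + y ^+ 2) / 2).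
Proof. by rewrite !std_normal_pdfE opprD mulrDl expRD; ring. Qed.

Lemma measurable_std_normal_pdf : measurable_fun setT (fun x => (phi x)%:E).
Proof. by apply/measurable_EFinP; exact: measurable_normal_pdf. Qed.

Lemma normal_probN (A : set R) : measurable A -> N (-%R @^-1` A) = N A.
Proof.
move=> mA; rewrite /normal_prob.
transitivity (\int[pushforward mu (-%R : _ -> measurableTypeR R)]_(x in A) (phi x)%:E)%E.
  have mN : @measurable_fun _ _ (measurableTypeR R) (measurableTypeR R) setT -%R.
    exact: oppr_measurable.
  rewrite (ge0_integral_pushforward mN); last 3 first.
  - exact: mA.
  - exact: (measurable_funTS measurable_std_normal_pdf).
  - by move=> x _; rewrite lee_fin normal_pdf_ge0.
  by apply: eq_integral => x _; rewrite /= !std_normal_pdfE sqrrN.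
by apply: eq_measure_integral => //= B mB _; exact: lebesgue_measureN.
Qed.

(** The substitution y = s x: Lebesgue measure is multiplied by s, and the density
    of variance s^2 at s x is the standard one at x divided by s. *)
Lemma normal_prob_scale (s : R) (A : set R) : 0 < s -> measurable A ->
  normal_prob 0 s A = N ((fun x => s * x) @^-1` A).
Proof.
move=> s0 mA; rewrite /normal_prob.
pose f := fun x : R => s * x.
have mf : measurable_fun setT f by exact: measurable_funM.
pose nu := mscale (NngNum (ltW s0)) (pushforward mu (f : _ -> measurableTypeR R)).
transitivity (\int[nu mf]_(x in A) (normal_pdf 0 s x)%:E)%E.
  apply: eq_measure_integral => //= B mB _; rewrite /mscale/= /pushforward.
  rewrite (lebesgue_affine 0 s0 mB); congr (_ * mu _)%E.
  by apply/seteqP; split => x /=; rewrite addr0.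
have mpdf : measurable_fun setT (fun x : R => (normal_pdf 0 s x)%:E).
  by apply/measurable_EFinP; exact: measurable_normal_pdf.
rewrite ge0_integral_mscale//=; last 2 first.
- exact: measurable_funTS.
- by move=> x _; rewrite lee_fin normal_pdf_ge0.
rewrite ge0_integral_pushforward//=; last 2 first.
- exact: measurable_funTS.
- by move=> x _; rewrite lee_fin normal_pdf_ge0.
rewrite -ge0_integralZl_EFin//=; last 4 first.
- exact: measurable_preimageT.
- by move=> x _; rewrite lee_fin normal_pdf_ge0.
- by apply: measurable_funTS; exact: (measurableT_comp mpdf mf).
- exact: ltW.
apply: eq_integral => x _; rewrite -EFinM; congr EFin.
rewrite std_normal_pdfE normal_pdfE ?gt_eqF// /normal_fun subr0 mulrA.
rewrite /normal_peak expr1n mul1r -mulrnAr sqrtrM ?sqr_ge0// sqrtr_sqr gtr0_norm//.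
rewrite invfM mulrA divff ?gt_eqF// mul1r; congr (_ * expR _).
by rewrite /f exprMn -mulr_natr; field; rewrite gt_eqF.
Qed.

Lemma prod_normalE (D : set (R * R)) : measurable D ->
  (N \x N)%E D = (\int[mu2]_(z in D) (phi z.1 * phi z.2)%:E)%E.
Proof.
move=> mD.
have mphiD : measurable_fun setT (fun z : R * R => ((fun z => (phi z.1 * phi z.2)%:E) \_ D) z).
  apply/(measurable_restrictT _ _).1 => //; apply: measurable_funTS.
  apply/measurable_EFinP; apply: measurable_funM; apply: measurableT_comp => //;
  exact: measurable_normal_pdf.
rewrite integral_mkcond fubini_tonelli1//; last first.
  by move=> z; rewrite erestrict_ge0// => y _; rewrite lee_fin mulr_ge0 ?normal_pdf_ge0.
rewrite /product_measure1 (@ge0_integral_density _ _ _ mu N phi)//; last 3 first.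
- exact: measurable_normal_pdf.
- by move=> x; exact: normal_pdf_ge0.
- exact: measurable_fun_xsection.
apply: eq_integral => x _; rewrite /fubini_F /=.
rewrite muleC /normal_prob integral_mkcond -ge0_integralZl_EFin//; last 3 first.
- by move=> y _; rewrite erestrict_ge0// => z _; rewrite lee_fin normal_pdf_ge0.
- apply/(measurable_restrictT _ _).1; first exact: measurable_xsection.
  by apply: measurable_funTS; exact: measurable_std_normal_pdf.
- exact: normal_pdf_ge0.
apply: eq_integral => y _; rewrite /patch mem_xsection.
by case: ifPn => _; rewrite ?mule0// EFinM.
Qed.

(** The product density depends only on x^2 + y^2, which rotations preserve, and so
    does Lebesgue measure. *)
Lemma prod_normal_rot (c s : R) (D : set (R * R)) :
  c ^+ 2 + s ^+ 2 = 1 -> s != 0 -> measurable D ->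
  (N \x N)%E (rot c s @^-1` D) = (N \x N)%E D.
Proof.
move=> cs s0 mD.
have mR := @measurable_rot R c s.
have mphi2 : measurable_fun setT (fun z : R * R => (phi z.1 * phi z.2)%:E).
  apply/measurable_EFinP; apply: measurable_funM; apply: measurableT_comp => //;
  exact: measurable_normal_pdf.
rewrite !prod_normalE//; last exact: measurable_preimageT.
pose Q := (measurableTypeR R * measurableTypeR R)%type.
transitivity (\int[pushforward mu2 (rot c s : Q -> Q)]_(z in D) (phi z.1 * phi z.2)%:E)%E.
  rewrite ge0_integral_pushforward; last 3 first.
  - exact: mD.
  - exact: (measurable_funTS mphi2).
  - by move=> z _; rewrite lee_fin mulr_ge0 ?normal_pdf_ge0.
  apply: eq_integral => z _; congr EFin; rewrite !std_normal_pdfM; congr (_ * expR _).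
  by congr (- _ / _); rewrite -[LHS]mul1r -cs /rot/=; ring.
  exact: mR.
by apply: eq_measure_integral => //= B mB _; exact: lebesgue2_rot.
Qed.

End normal.

(** * Second moment of the standard normal law *)

Section moments.
Context {R : realType}.
Local Notation mu := (@lebesgue_measure R).
Local Notation N := (@normal_prob R 0 1).
Local Notation phi := (@normal_pdf R 0 1).

Lemma continuous_std_normal_pdf : continuous phi.
Proof. by apply: continuous_normal_pdf; exact: oner_neq0. Qed.

Lemma cvg_std_normal_pdf : phi x @[x --> +oo] --> (0 : R).
Proof.
have s2 : 0 < (Num.sqrt 2)^-1 :> R by rewrite invr_gt0 sqrtr_gt0.
have -> : phi = (fun x => normal_peak 1 * (gauss_fun \o (fun x => x * (Num.sqrt 2)^-1)) x).
  apply/funext => x; rewrite std_normal_pdfE /= /gauss_fun exprMn exprVn sqr_sqrtr//.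
  by rewrite mulNr.
rewrite -[X in _ --> X](mulr0 (@normal_peak R 1)).
apply: cvgMr; apply: (cvg_comp _ _ _ cvg_gauss_fun).
exact: (gt0_cvgMly s2 cvg_id).
Qed.

Lemma is_derive_std_normal_pdf (x : R) : is_derive x (1 : R) phi (- x * phi x).
Proof.
have -> : phi = (cst (normal_peak 1) : R -> R) * (expR \o (cst (- 2^-1) * (@id R ^+ 2))).
  apply/funext => y; rewrite std_normal_pdfE; congr (_ * expR _).
  by rewrite !fctE /=; lra.
apply: is_derive_eq.
rewrite !fctE /cst /= /GRing.scale /= /GRing.scale /=.
by field.
Qed.

(** The integrand is minus the derivative of the density. *)
Lemma integral_id_std_normal_pdf (t : R) : 0 <= t ->
  (\int[mu]_(x in `[t, +oo[) (x * phi x)%:E = (phi t)%:E)%E.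
Proof.
move=> t0.
rewrite (@ge0_continuous_FTC2y _ _ (fun x => - phi x) t 0).
- by rewrite -EFinB sub0r opprK.
- by move=> x tx; rewrite mulr_ge0 ?normal_pdf_ge0// (le_trans t0).
- apply: continuous_subspaceT => x; apply: cvgM; first exact: cvg_id.
  exact: continuous_std_normal_pdf.
- by rewrite -[X in _ --> X]oppr0; apply: cvgN; exact: cvg_std_normal_pdf.
- by move=> x _; apply: derivableN; have [] := is_derive_std_normal_pdf x.
- by apply: cvgN; apply: cvg_at_right_filter; exact: continuous_std_normal_pdf.
- move=> x _; rewrite derive1E; have D := is_derive_std_normal_pdf x.
  have -> : 'D_1 (- phi) x = - (- x * phi x) by apply: derive_val.
  by rewrite mulNr opprK.
Qed.

(** On the half line, write x^2 phi(x) as the integral of x phi(x) over t in [0, x].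
    Exchanging the integrals, the inner one becomes the integral of x phi(x) over
    [t, +oo[, which is phi(t); so the second moment equals the total mass. *)
Lemma integral_sqr_std_normal_pdf : (\int[mu]_x (x ^+ 2 * phi x)%:E = 1)%E.
Proof.
have mxphi : measurable_fun setT (fun x : R => x * phi x).
  by apply: measurable_funM => //; exact: measurable_normal_pdf.
have phi0 x : 0 <= phi x by exact: normal_pdf_ge0.
have nneg : [set x : R | 0 <= x] = `[0%R, +oo[%classic.
  by apply/seteqP; split => x/=; rewrite in_itv/= andbT.
suff half : (\int[mu]_(x in `[0%R, +oo[) (x ^+ 2 * phi x)%:E =
             \int[mu]_(x in `[0%R, +oo[) (phi x)%:E)%E.
  rewrite ge0_symfun_integralT; last 3 first.
  - by move=> x; rewrite mulr_ge0 ?sqr_ge0.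
  - by move=> x; apply: cvgM; [exact: exprn_continuous|exact: continuous_std_normal_pdf].
  - by move=> x; rewrite /= !std_normal_pdfE !sqrrN.
  rewrite nneg half -nneg -ge0_symfun_integralT ?integral_normal_pdf//.
  - exact: continuous_std_normal_pdf.
  - by move=> x; rewrite /= !std_normal_pdfE sqrrN.
(* The integrand of the double integral: z.1 is the auxiliary variable t. *)
pose K z : R := if (0 <= z.1) && (z.1 <= z.2) then z.2 * phi z.2 else 0.
have mK : measurable_fun setT (fun z => (K z)%:E).
  apply/measurable_EFinP; apply: measurable_fun_ifT => //.
    by apply: measurable_and; apply: measurable_fun_ler.
  by apply: (measurableT_comp mxphi).
have K0 z : (0 <= (K z)%:E)%E.
  rewrite lee_fin /K; case: ifPn => // /andP[z1 z2].
  by rewrite mulr_ge0// (le_trans z1).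
transitivity (\int[mu]_x \int[mu]_t (K (t, x))%:E)%E.
  rewrite integral_mkcond; apply: eq_integral => x _; rewrite /patch.
  case: ifPn => [|]; last first.
    rewrite notin_setE /= in_itv /= andbT => /negP; rewrite -ltNge => x0.
    rewrite integral0_eq// => t _; rewrite /K /=.
    by case: ifPn => // /andP[t0 tx]; have := le_lt_trans (le_trans t0 tx) x0; rewrite ltxx.
  rewrite inE /= in_itv /= andbT => x0.
  transitivity (\int[mu]_(t in `[0%R, x]) (x * phi x)%:E)%E.
    rewrite integral_cst//= lebesgue_measure_itv/= lte_fin.
    move: x0; rewrite le_eqVlt => /predU1P[<-|x0].
      by rewrite ltxx expr2 !mul0r mule0.
    by rewrite x0 -EFinB -EFinM subr0; congr EFin; ring.
  rewrite integral_mkcond; apply: eq_integral => t _; rewrite /patch /K /=.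
  by rewrite mem_setE /= in_itv /=; case: ifP.
rewrite -(@fubini_tonelli _ _ _ _ _ mu mu (fun z => (K z)%:E))//.
rewrite [RHS]integral_mkcond; apply: eq_integral => t _; rewrite /patch.
case: ifPn => [|]; last first.
  rewrite notin_setE /= in_itv /= andbT => /negP t0.
  rewrite integral0_eq// => x _; rewrite /K /=.
  by rewrite (negbTE t0).
rewrite inE /= in_itv /= andbT => t0; rewrite -integral_id_std_normal_pdf//.
rewrite [RHS]integral_mkcond; apply: eq_integral => x _; rewrite /patch /K /=.
by rewrite mem_setE /= in_itv /= andbT t0 /=; case: ifP.
Qed.

Lemma normal_second_moment : (\int[N]_x (x ^+ 2)%:E = 1)%E.
Proof.
rewrite (@ge0_integral_density _ _ _ mu N phi)//.
- by under eq_integral do rewrite -EFinM; exact: integral_sqr_std_normal_pdf.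
- exact: measurable_normal_pdf.
- by move=> x; exact: normal_pdf_ge0.
- by apply/measurable_EFinP; exact: measurable_funX.
- by move=> x; rewrite lee_fin sqr_ge0.
Qed.

End moments.

(** * Finite families of independent standard normal variables *)

Section pi_lambda.
Context d (Omega : measurableType d) (R : realType) (P : probability Omega R).

Definition pi_system (G : set_system Omega) :=
  [/\ G `<=` measurable, setI_closed G & G setT].

Lemma pi_system_measurable G : pi_system G -> <<s G >> `<=` measurable.
Proof.
by move=> [mG _ _]; apply: smallest_sub => //; exact: sigma_algebra_measurable.
Qed.

(** For a fixed F, both sides are finite measures in E, so they are determined by
    their values on a pi-system. *)
Lemma indep_pi_systems_l (G : set_system Omega) (F : set Omega) :
  pi_system G -> measurable F ->
  (forall E, G E -> P (E `&` F) = (P E * P F)%E) ->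
  forall E, <<s G >> E -> P (E `&` F) = (P E * P F)%E.
Proof.
move=> [mG IG GT] mF indG E sE.
have PF : (fine (P F))%:E = P F by rewrite fineK// fin_num_measure.
pose m2 := mscale (NngNum (fine_ge0 (measure_ge0 P F))) P.
have m2E A : m2 A = (P A * P F)%E by rewrite /m2/= /mscale/= PF muleC.
rewrite -m2E.
apply: (@g_sigma_algebra_measure_unique _ _ _ G mG (fun=> setT) (fun=> GT) _
  (mrestr P mF) m2 IG _ _ E sE).
- by rewrite bigcup_const//; exists 0%N.
- by move=> A GA; transitivity (P A * P F)%E; [exact: indG|rewrite -m2E].
- by move=> _; rewrite -[ltLHS]/(P (setT `&` F)) setTI ltey_eq fin_num_measure.
Qed.

Lemma indep_pi_systems (G H : set_system Omega) :
  pi_system G -> pi_system H -> indep_systems P G H ->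
  indep_systems P <<s G >> <<s H >>.
Proof.
move=> piG piH ind E F sE sF.
apply: (indep_pi_systems_l piG) => // [|A GA].
  exact: (pi_system_measurable piH).
rewrite setIC muleC; apply: (indep_pi_systems_l piH) => // [|B HB].
  by case: piG => + _ _; exact.
by rewrite setIC muleC; exact: ind.
Qed.

End pi_lambda.

Section iid.
Context d (Omega : measurableType d) (R : realType) (P : probability Omega R).
Local Notation N := (@normal_prob R 0 1).

Definition std_normal (X : Omega -> R) :=
  measurable_fun setT X /\ forall A, measurable A -> P (X @^-1` A) = N A.

(** Independence and the marginal laws in a single formula: taking all but one of
    the A_k to be the full line gives the law of one variable. *)
Definition iid_normal (I : finType) (g : I -> Omega -> R) :=
  (forall k, measurable_fun setT (g k)) /\
  forall A : I -> set R, (forall k, measurable (A k)) ->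
    P (\bigcap_k (g k @^-1` A k)) = (\prod_k N (A k))%E.

(** The members of J are constrained to lie in given Borel sets, the others are
    free; the sigma-algebra generated by these events is that of the subfamily J.
    Stating them with a set for every index keeps them closed under intersection
    without any reindexing. *)
Definition cylinder (I : finType) (g : I -> Omega -> R) (J : pred I) : set_system Omega :=
  [set E | exists A : I -> set R, [/\ forall k, measurable (A k),
    forall k, ~~ J k -> A k = setT & E = \bigcap_k (g k @^-1` A k)]].

Variables (I : finType) (g : I -> Omega -> R).
Hypothesis ig : iid_normal g.

Lemma iid_normal_std k : std_normal (g k).
Proof.
split=> [|B mB]; first by case: ig.
pose A i := if i == k then B else setT.
have mA i : measurable (A i) by rewrite /A; case: ifP.
have <- : \bigcap_i (g i @^-1` A i) = g k @^-1` B.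
  apply/seteqP; split=> [w /(_ k Logic.I)|w Bw i _]; rewrite /A ?eqxx//=.
  by case: eqP => // ->.
rewrite (proj2 ig) // (bigD1 k)//= big1 ?mule1.
  by rewrite /A eqxx.
by move=> i /negPf ik; rewrite /A ik probability_setT.
Qed.

Lemma cylinder_pi_system J : pi_system (cylinder g J).
Proof.
split.
- move=> _ [A [mA _ ->]]; apply: fin_bigcap_measurable => // k _.
  by apply: measurable_preimageT => //; case: ig.
- move=> _ _ [A [mA AJ ->]] [B [mB BJ ->]].
  exists (fun k => A k `&` B k); split.
  + by move=> k; exact: measurableI.
  + by move=> k kJ; rewrite AJ// BJ// setIT.
  + by rewrite -bigcapI.
- by exists (fun=> setT); split => //; apply/seteqP; split.
Qed.

(** On cylinders the product formula holds factor by factor, since at each index one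
    of the two constraints is void. *)
Lemma indep_cylinder (J K : pred I) : (forall k, J k -> ~~ K k) ->
  indep_systems P <<s cylinder g J >> <<s cylinder g K >>.
Proof.
move=> JK; apply: indep_pi_systems; [exact: cylinder_pi_system..|].
move=> _ _ [A [mA AJ ->]] [B [mB BK ->]].
rewrite -bigcapI (_ : \bigcap_k _ = \bigcap_k (g k @^-1` (A k `&` B k)))//.
rewrite !(proj2 ig)//; last by move=> k; exact: measurableI.
rewrite -big_split/=; apply: eq_bigr => k _.
have [kJ|kJ] := boolP (J k).
  by rewrite BK ?JK// setIT probability_setT mule1.
by rewrite AJ// setTI probability_setT mul1e.
Qed.

Lemma cylinder_preimage (J : pred I) k (B : set R) : J k -> measurable B ->
  <<s cylinder g J >> (g k @^-1` B).
Proof.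
move=> kJ mB; apply: sub_sigma_algebra.
exists (fun i => if i == k then B else setT); split.
- by move=> i; case: ifP.
- by move=> i; case: eqP => // ->; rewrite kJ.
- apply/seteqP; split=> [w Bw i _|w /(_ k Logic.I)]; last by rewrite /= eqxx.
  by rewrite /=; case: eqP => // ->.
Qed.

Lemma cylinder_measurable (J : pred I) k : J k ->
  @measurable_fun _ _ (g_sigma_algebraType (cylinder g J)) R setT (g k).
Proof. by move=> kJ _ B mB; rewrite setTI; exact: cylinder_preimage. Qed.

Lemma indep_families_cylinder (J K : pred I) d1 d2 (E1 : measurableType d1)
    (E2 : measurableType d2) (S T : Type) (X : S -> Omega -> E1) (Y : T -> Omega -> E2) :
  (forall k, J k -> ~~ K k) ->
  (forall s, @measurable_fun _ _ (g_sigma_algebraType (cylinder g J)) _ setT (X s)) ->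
  (forall t, @measurable_fun _ _ (g_sigma_algebraType (cylinder g K)) _ setT (Y t)) ->
  indep_families P X Y.
Proof.
move=> JK mX mY A B sA sB; apply: (indep_cylinder JK).
- move: A sA; apply: smallest_sub; first exact: smallest_sigma_algebra.
  by move=> _ [s _ [B' mB' <-]]; exact: mX.
- move: B sB; apply: smallest_sub; first exact: smallest_sigma_algebra.
  by move=> _ [s _ [B' mB' <-]]; exact: mY.
Qed.

Lemma indep_rv_cylinder (J K : pred I) d1 d2 (E1 : measurableType d1)
    (E2 : measurableType d2) (X : Omega -> E1) (Y : Omega -> E2) :
  (forall k, J k -> ~~ K k) ->
  @measurable_fun _ _ (g_sigma_algebraType (cylinder g J)) _ setT X ->
  @measurable_fun _ _ (g_sigma_algebraType (cylinder g K)) _ setT Y ->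
  indep_rv P X Y.
Proof.
move=> JK mX mY _ _ [A mA <-] [B mB <-]; apply: (indep_cylinder JK).
- exact: mX.
- exact: mY.
Qed.

End iid.

Section rotation.
Context d (Omega : measurableType d) (R : realType) (P : probability Omega R).
Local Notation N := (@normal_prob R 0 1).
Variables (I : finType) (g : I -> Omega -> R).
Hypothesis ig : iid_normal P g.

(** A measure on the plane is determined by its values on rectangles. *)
Lemma iid_normal_pair i j (D : set (R * R)) : i != j -> measurable D ->
  P ((fun w => (g i w, g j w)) @^-1` D) = (N \x N)%E D.
Proof.
move=> ij mD; have mg k : measurable_fun setT (g k) by case: ig.
pose RR : measurableType _ := (measurableTypeR R * measurableTypeR R)%type.
have mgg : @measurable_fun _ _ Omega RR setT (fun w => (g i w, g j w)).
  exact: (measurable_fun_pair (mg i) (mg j)).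
pose X : {mfun Omega >-> RR} := @mfun_Sub _ _ Omega RR _ (mem_set mgg).
rewrite (@product_measure_unique _ _ _ _ _ N N (distribution P X))// => A B mA mB.
have dij k : k == i -> k != j by move=> /eqP->.
rewrite -[LHS]/(P ((g i @^-1` A) `&` (g j @^-1` B))).
rewrite (@indep_cylinder _ _ _ _ _ _ ig (pred1 i) (pred1 j) dij).
- by rewrite !(proj2 (iid_normal_std ig _)).
- by apply: cylinder_preimage => //=.
- by apply: cylinder_preimage => //=.
Qed.

Definition rotate (i j : I) (c s : R) (k : I) (w : Omega) : R :=
  if k == i then c * g i w + s * g j w
  else if k == j then - s * g i w + c * g j w else g k w.

(** The rotated pair is a function of the two chosen members, hence independent of
    the others, and its own law is the product law by rotation invariance. *)
Lemma iid_normal_rotate i j (c s : R) : i != j -> c ^+ 2 + s ^+ 2 = 1 -> s != 0 ->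
  iid_normal P (rotate i j c s).
Proof.
move=> ij cs s0; have mg k : measurable_fun setT (g k) by case: ig.
have ji : (j == i) = false by rewrite eq_sym (negbTE ij).
split.
  move=> k; rewrite /rotate; case: eqP => _.
    by apply: measurable_funD; exact: measurable_funM.
  by case: eqP => _//; apply: measurable_funD; exact: measurable_funM.
move=> A mA.
(* The constraints on the untouched members, void at i and j. *)
pose A' k := if (k == i) || (k == j) then setT else A k.
have mA' k : measurable (A' k) by rewrite /A'; case: ifP.
pose E := (fun w => (g i w, g j w)) @^-1` (rot c s @^-1` (A i `*` A j)).
have mAA : measurable (rot c s @^-1` (A i `*` A j)).
  by apply: measurable_preimageT; [exact: measurable_rot|exact: measurableX].
have -> : \bigcap_k rotate i j c s k @^-1` A k = E `&` \bigcap_k (g k @^-1` A' k).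
  apply/seteqP; split=> w.
    move=> Aw; split.
      split; first by have := Aw i Logic.I; rewrite /= /rotate eqxx.
      by have := Aw j Logic.I; rewrite /= /rotate ji eqxx.
    move=> k _; rewrite /A' /=; case: ifPn => //; rewrite negb_or => /andP[ki kj].
    by have := Aw k Logic.I; rewrite /= /rotate (negbTE ki) (negbTE kj).
  move=> [[/= Ai Aj] Aw] k _; rewrite /= /rotate.
  have [->//|ki] := eqVneq k i; have [->//|kj] := eqVneq k j.
  by have := Aw k Logic.I; rewrite /A' (negbTE ki) (negbTE kj).
pose J := [pred k | (k == i) || (k == j)].
have JK k : J k -> ~~ predC J k by rewrite /= negbK.
rewrite (@indep_cylinder _ _ _ _ _ _ ig J (predC J) JK); last 2 first.
- have m2 : @measurable_fun _ _ (g_sigma_algebraType (cylinder g J)) _ setT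
      (fun w => (g i w, g j w)).
    by apply: measurable_fun_pair; apply: cylinder_measurable; rewrite /= eqxx ?orbT.
  rewrite -[X in <<s _ >> X]setTI; exact: m2.
- apply: sub_sigma_algebra; exists A'; split => // k.
  by rewrite /= negbK /A' => ->.
rewrite iid_normal_pair// prod_normal_rot//; last exact: measurableX.
rewrite (proj2 ig)// product_measure1E; [|exact: mA..].
rewrite [RHS](bigD1 i)//= [in RHS](bigD1 j) ?ji//=.
rewrite (bigD1 i)//= [in LHS](bigD1 j) ?ji//= /A' !eqxx orbT probability_setT !mul1e.
rewrite muleA; congr (_ * _)%E; apply: eq_bigr => k /andP[ki kj].
by rewrite (negbTE ki) (negbTE kj).
Qed.

End rotation.

(** * Moments and scaling of a standard normal variable *)

Section standard_normal.
Context d (Omega : measurableType d) (R : realType) (P : probability Omega R).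
Local Notation N := (@normal_prob R 0 1).

Lemma std_normalN (Z : Omega -> R) :
  std_normal P Z -> std_normal P (fun w => - Z w).
Proof.
move=> [mZ PZ]; split=> [|A mA]; first exact: measurable_funN.
rewrite -(normal_probN mA) -PZ//.
by apply: (measurable_preimageT (f := -%R : R -> R)).
Qed.

(** The case r = 0 gives the Dirac mass, and a negative r is absorbed by the symmetry
    of the standard normal law. *)
Lemma gaussian_rv_scale (r : R) (Z : Omega -> R) :
  std_normal P Z -> gaussian_rv P (fun w => r * Z w) 0 (r ^+ 2).
Proof.
move=> nZ; split; [|exact: sqr_ge0|].
  by apply: measurable_funM => //; case: nZ.
move=> A mA; rewrite sqrf_eq0 sqrtr_sqr.
have pos (s : R) (Y : Omega -> R) : std_normal P Y -> 0 < s ->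
    P ((fun w => s * Y w) @^-1` A) = normal_prob 0 s A.
  move=> [mY PY] s0; rewrite normal_prob_scale// -PY//.
  by apply: (measurable_preimageT (f := fun x : R => s * x)) => //; exact: measurable_funM.
have [->|r0] := eqVneq r 0.
  rewrite diracE; under eq_fun do rewrite mul0r.
  rewrite preimage_cst; case: ifP => _; by rewrite ?probability_setT ?measure0.
have [rpos|rneg] := ltP 0 r; first by rewrite gtr0_norm//; exact: pos.
have {}rneg : r < 0 by rewrite lt_neqAle r0.
have -> : (fun w => r * Z w) = (fun w => - r * - Z w).
  by apply/funext => w; rewrite mulrNN.
by rewrite ltr0_norm// (pos _ _ (std_normalN nZ)) ?oppr_gt0.
Qed.

Lemma std_normal_integral (f : R -> \bar R) (Z : Omega -> R) :
  std_normal P Z -> measurable_fun setT f -> (forall x, 0 <= f x)%E ->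
  (\int[P]_w f (Z w) = \int[N]_x f x)%E.
Proof.
move=> [mZ PZ] mf f0.
have mZ' : @measurable_fun _ _ Omega (measurableTypeR R) setT Z by [].
pose Z' : {mfun Omega >-> measurableTypeR R} :=
  @mfun_Sub _ _ Omega (measurableTypeR R) _ (mem_set mZ').
rewrite -(@ge0_integral_distribution _ _ _ _ _ P Z')//.
by apply: eq_measure_integral => A mA _; exact: PZ.
Qed.

Lemma std_normal_sqr (Z : Omega -> R) : std_normal P Z ->
  (\int[P]_w (Z w ^+ 2)%:E = 1)%E.
Proof.
move=> nZ; rewrite (std_normal_integral (f := fun x => (x ^+ 2)%:E) nZ).
- exact: normal_second_moment.
- by apply/measurable_EFinP; exact: measurable_funX.
- by move=> x; rewrite lee_fin sqr_ge0.
Qed.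

Lemma std_normal_sqr_Lfun (Z : Omega -> R) : std_normal P Z ->
  (fun w => Z w ^+ 2) \in Lfun P 1%E.
Proof.
move=> nZ; apply/Lfun1_integrable/integrableP; split.
  by apply/measurable_EFinP; apply: measurable_funX; case: nZ.
under eq_integral do rewrite /= ger0_norm ?sqr_ge0//.
by rewrite std_normal_sqr// ltry.
Qed.

Lemma std_normal_Lfun (Z : Omega -> R) : std_normal P Z -> Z \in Lfun P 1%E.
Proof.
move=> nZ; apply/Lfun1_integrable.
have mZ : measurable_fun setT Z by case: nZ.
have /Lfun1_integrable i2 := std_normal_sqr_Lfun nZ.
apply: (@le_integrable _ _ _ _ _ measurableT _ (fun w => (1 + Z w ^+ 2)%:E)).
- exact/measurable_EFinP.
- move=> w _; rewrite /= lee_fin [leRHS]ger0_norm ?addr_ge0 ?sqr_ge0//.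
  have := sqr_ge0 (`|Z w| - 1); rewrite -(real_normK (num_real (Z w))).
  by have := normr_ge0 (Z w); nra.
- under eq_fun do rewrite EFinD.
  by apply: integrableD => //; exact: finite_measure_integrable_cst.
Qed.

(** Z and - Z have the same law, hence the same expectation, which is finite. *)
Lemma std_normal_expectation (Z : Omega -> R) : std_normal P Z -> ('E_P[Z] = 0)%E.
Proof.
move=> nZ; have LZ := std_normal_Lfun nZ.
have nZN := std_normalN nZ.
suff EN : ('E_P[Z] = 'E_P[((-1) \o* Z)%R])%E.
  have fE := expectation_fin_num LZ.
  move: EN; rewrite (expectationZl (-1) LZ) -[X in X = _](fineK fE) -(fineK fE) -EFinM.
  by move=> [] E; congr EFin; lra.
rewrite unlock.
have law (Y : Omega -> R) : std_normal P Y -> (\int[P]_w (Y w)%:E =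
   \int[N]_x (Num.max x 0)%:E - \int[N]_x (Num.max (- x) 0)%:E)%E.
  move=> nY; rewrite -(std_normal_integral (f := fun x => (Num.max x 0)%:E) nY); last 2 first.
  - by apply/measurable_EFinP; exact: measurable_maxr.
  - by move=> x; rewrite lee_fin le_max lexx orbT.
  rewrite -(std_normal_integral (f := fun x => (Num.max (- x) 0)%:E) nY); last 2 first.
  - by apply/measurable_EFinP; apply: measurable_maxr.
  - by move=> x; rewrite lee_fin le_max lexx orbT.
  rewrite integralE; congr (_ - _)%E; apply: eq_integral => w _.
  - by rewrite funeposE EFin_max.
  - by rewrite funenegE EFin_max.
rewrite law//; under [RHS]eq_integral do rewrite /= mulrN1.
by rewrite (law (fun w => - Z w)).
Qed.

End standard_normal.

(** * Orthogonal changes of variables and linear combinations *)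

Section families.
Context d (Omega : measurableType d) (R : realType) (P : probability Omega R).
Local Notation N := (@normal_prob R 0 1).
Variables (I : finType) (g : I -> Omega -> R).
Hypothesis ig : iid_normal P g.

(** The partial sum is kept in the form r * h k0, where h is an iid family that has
    not been modified at the indices still to come; adding the term k is a rotation
    of the pair k0, k. The factor r may be negative. *)
Lemma iid_normal_lincomb_seq (c : I -> R) k0 (s : seq I) : uniq (k0 :: s) ->
  exists (h : I -> Omega -> R) (r : R), [/\ iid_normal P h,
    forall k, k \notin k0 :: s -> h k = g k,
    r ^+ 2 = \sum_(k <- k0 :: s) c k ^+ 2 &
    forall w, \sum_(k <- k0 :: s) c k * g k w = r * h k0 w].
Proof.
elim: s => [_|k s IHs /= /andP[]].
  by exists g, (c k0); split=> // [|w]; rewrite big_seq1.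
rewrite inE negb_or => /andP[k0k k0s] /andP[ks us].
have [|h [r [ih hg r2 hr]]] := IHs; first by rewrite /= k0s.
have hk : h k = g k by apply: hg; rewrite inE negb_or eq_sym k0k.
have perm (F : I -> R) : \sum_(i <- [:: k0, k & s]) F i = \sum_(i <- k0 :: s) F i + F k.
  by rewrite !big_cons addrCA addrC.
(* A zero coefficient is skipped: the rotation requires a nonzero sine. *)
have [ck|ck] := eqVneq (c k) 0.
  exists h, r; split=> // [i|| w]; last 2 first.
  - by rewrite perm ck expr0n addr0.
  - by rewrite perm ck mul0r addr0.
  by rewrite !inE !negb_or => /and3P[ik0 _ iks]; apply: hg; rewrite inE negb_or ik0.
pose rho := Num.sqrt (r ^+ 2 + c k ^+ 2).
have sum_gt0 : 0 < r ^+ 2 + c k ^+ 2.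
  by rewrite ltr_wpDl ?sqr_ge0// lt_neqAle sqr_ge0 eq_sym sqrf_eq0 ck.
have rho0 : rho != 0 by rewrite gt_eqF// sqrtr_gt0.
have rho2 : rho ^+ 2 = r ^+ 2 + c k ^+ 2 by rewrite sqr_sqrtr// ltW.
exists (rotate h k0 k (r / rho) (c k / rho)), rho; split.
- apply: iid_normal_rotate => //; last by rewrite mulf_neq0// invr_eq0.
  by rewrite !exprMn -mulrDl -rho2 exprVn divff// sqrf_eq0.
- move=> i; rewrite !inE !negb_or => /and3P[ik0 ik iks].
  apply/funext => w; rewrite /rotate (negbTE ik0) (negbTE ik) hg//.
  by rewrite inE negb_or ik0.
- by rewrite perm rho2 r2.
- by move=> w; rewrite perm hr /rotate eqxx -hk; field.
Qed.

Lemma iid_normal_lincomb (c : I -> R) :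
  (exists Z r, [/\ std_normal P Z, r ^+ 2 = \sum_k c k ^+ 2 &
    forall w, \sum_k c k * g k w = r * Z w]) \/ forall k : I, False.
Proof.
case: (pickP (@predT I)) => [k0 _|noI]; last by right=> k; have := noI k.
left; have [|h [r [ih _ r2 hr]]] := @iid_normal_lincomb_seq c k0 (rem k0 (enum I)).
  by rewrite /= mem_rem_uniq ?enum_uniq// inE eqxx /= rem_uniq// enum_uniq.
have perm (F : I -> R) : \sum_k F k = \sum_(k <- k0 :: rem k0 (enum I)) F k.
  by rewrite -big_enum; apply: perm_big; apply: perm_to_rem; rewrite mem_enum.
exists (h k0), r; split; first exact: iid_normal_std.
- by rewrite perm.
- by move=> w; rewrite perm.
Qed.

Definition lincomb (c : I -> R) (w : Omega) : R := \sum_k c k * g k w.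

Lemma lincomb_gaussian c : gaussian_rv P (lincomb c) 0 (\sum_k c k ^+ 2).
Proof.
have [[Z [r [nZ <- E]]]|noI] := iid_normal_lincomb c.
  by rewrite (_ : lincomb c = (fun w => r * Z w)); [exact: gaussian_rv_scale|exact/funext].
rewrite big1; last by move=> k; have := noI k.
have -> : lincomb c = cst 0 by apply/funext => w; rewrite /lincomb big1// => k; have := noI k.
split=> // A mA; rewrite eqxx diracE preimage_cst.
by case: ifP => _; rewrite ?probability_setT ?measure0.
Qed.

Lemma lincomb_expectation c : ('E_P[lincomb c] = 0)%E.
Proof.
have [[Z [r [nZ _ E]]]|noI] := iid_normal_lincomb c.
  rewrite (_ : lincomb c = r \o* Z)%R; last by apply/funext => w; rewrite /= mulrC -E.
  rewrite expectationZl; last exact: std_normal_Lfun.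
  by rewrite std_normal_expectation// mule0.
have -> : lincomb c = cst 0 by apply/funext => w; rewrite /lincomb big1// => k; have := noI k.
by rewrite expectation_cst.
Qed.

Lemma lincomb_sqr c : (fun w => lincomb c w ^+ 2) \in Lfun P 1%E /\
  ('E_P[fun w => (lincomb c w ^+ 2)%R] = (\sum_k c k ^+ 2)%:E)%E.
Proof.
have [[Z [r [nZ <- E]]]|noI] := iid_normal_lincomb c.
  have -> : (fun w => lincomb c w ^+ 2) = (r ^+ 2 \o* (fun w => Z w ^+ 2))%R.
    by apply/funext => w; rewrite /lincomb E /= exprMn mulrC.
  have LZ := std_normal_sqr_Lfun nZ; split.
    exact: Lfun_scale.
  rewrite expectationZl//.
  by rewrite unlock (std_normal_sqr nZ) mule1.
have E (f : I -> R) : \sum_k f k = 0 by rewrite big1// => k; have := noI k.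
rewrite E; under eq_fun do rewrite /lincomb E expr0n.
by split; [exact: Lfun_cst|rewrite expectation_cst].
Qed.

(** Polarization: the product of two combinations is the difference of the squares of
    their half sum and half difference. *)
Lemma lincomb_cov c e :
  ('E_P[fun w => (lincomb c w * lincomb e w)%R] = (\sum_k c k * e k)%:E)%E.
Proof.
have [L1 E1] := lincomb_sqr (fun k => (c k + e k) / 2).
have [L2 E2] := lincomb_sqr (fun k => (c k - e k) / 2).
have comb w : lincomb c w * lincomb e w =
    lincomb (fun k => (c k + e k) / 2) w ^+ 2 - lincomb (fun k => (c k - e k) / 2) w ^+ 2.
  have -> : lincomb (fun k => (c k + e k) / 2) w = (lincomb c w + lincomb e w) / 2.
    by rewrite /lincomb -big_split/= mulr_suml; apply: eq_bigr => k _; ring.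
  have -> : lincomb (fun k => (c k - e k) / 2) w = (lincomb c w - lincomb e w) / 2.
    rewrite /lincomb -sumrN -big_split/= mulr_suml; apply: eq_bigr => k _; ring.
  by field.
under eq_fun do rewrite comb.
rewrite (expectationB L1 L2) E1 E2 -EFinB -sumrB; congr EFin.
by apply: eq_bigr => k _; field.
Qed.

Variables (tau : I -> I) (sg : I -> bool).
Hypotheses (tauK : involutive tau) (sg_tau : forall i, sg (tau i) = ~~ sg i).

(** On a pair {i, tau i} with [sg i], these are the coordinates rotated by pi/4,
    (g_i + g_(tau i)) / sqrt 2 and (g_(tau i) - g_i) / sqrt 2. *)
Definition symmetrized (i : I) (w : Omega) : R :=
  (g i w + (-1) ^+ (~~ sg i) * g (tau i) w) / Num.sqrt 2.

(** One rotation by pi/4 for each pair; the pairs are disjoint, so the rotations do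
    not interfere. *)
Lemma iid_normal_symmetrized : iid_normal P symmetrized.
Proof.
have s20 : Num.sqrt 2 != 0 :> R by rewrite gt_eqF// sqrtr_gt0.
(* The family after the pairs met by s have been rotated. *)
pose fam (s : seq I) k := if (k \in s) || (tau k \in s) then symmetrized k else g k.
have tau_neq i : i != tau i.
  by apply/eqP => /(congr1 sg); rewrite sg_tau; case: (sg i).
have step s : uniq s -> all sg s -> iid_normal P (fam s).
  elim: s => [|i s IHs] //= /andP[is_ us] /andP[si ss].
  have tis : tau i \notin s.
    by apply/negP => /(allP ss); rewrite sg_tau si.
  have fi : fam s i = g i by rewrite /fam (negbTE is_) (negbTE tis).
  have fti : fam s (tau i) = g (tau i).
    by rewrite /fam tauK (negbTE is_) (negbTE tis).
  rewrite (_ : fam (i :: s) = rotate (fam s) i (tau i) (Num.sqrt 2)^-1 (Num.sqrt 2)^-1).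
    apply: iid_normal_rotate; [exact: IHs|exact: tau_neq| |by rewrite invr_eq0].
    by rewrite exprVn sqr_sqrtr//; field.
  apply/funext => k; apply/funext => w; rewrite /rotate fi fti /fam !inE.
  have [->|ki] := eqVneq k i.
    by rewrite /symmetrized si expr0; field.
  have [->|kti] := eqVneq k (tau i).
    by rewrite tauK eqxx orbT /symmetrized tauK sg_tau si expr1; field.
  by rewrite (can2_eq tauK tauK) (negbTE kti).
rewrite (_ : symmetrized = fam [seq i <- enum I | sg i]).
  by apply: step; [exact: filter_uniq (enum_uniq _)|exact: filter_all].
have memE i : (i \in [seq i <- enum I | sg i]) = sg i.
  by rewrite mem_filter fintype.mem_enum andbT.
apply/funext => k; rewrite /fam !memE sg_tau.
by case: (sg k).
Qed.

End families.

Section law.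
Context d (Omega : measurableType d) (R : realType) (P : probability Omega R).

(** The two laws agree on the pi-system of finite-dimensional rectangles, which
    generates the product sigma-algebra. *)
Lemma iid_normal_same_joint_law (I : finType) (g h : I -> Omega -> R) :
  iid_normal P g -> iid_normal P h -> same_joint_law P g h.
Proof.
move=> [mg Pg] [mh Ph].
pose C : set_system (I -> R) := [set E | exists A : I -> set R,
  (forall k, measurable (A k)) /\ E = [set f | forall k, A k (f k)]].
pose T : measurableType _ := g_sigma_algebraType C.
have mT (f : I -> Omega -> R) : (forall k, measurable_fun setT (f k)) ->
    @measurable_fun _ _ Omega T setT (fun w => f ^~ w).
  move=> mf; apply: (@measurability _ _ _ T setT _ C) => //.
  move=> _ [_ [A [mA ->]] <-]; rewrite setTI.
  rewrite (_ : _ @^-1` _ = \bigcap_k (f k @^-1` A k)).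
    by apply: fin_bigcap_measurable => // k _; exact: measurable_preimageT.
  by apply/seteqP; split=> w fw k => [_|]; exact: fw.
pose G : {mfun Omega >-> T} := @mfun_Sub _ _ Omega T _ (mem_set (mT g mg)).
pose H : {mfun Omega >-> T} := @mfun_Sub _ _ Omega T _ (mem_set (mT h mh)).
have CT : C setT by exists (fun=> setT); split => //; apply/seteqP; split.
have law A : <<s C >> A -> distribution P G A = distribution P H A.
  apply: (@g_sigma_algebra_measure_unique _ _ T C _ (fun=> setT)) => //.
  - by move=> B CB; exact: sub_sigma_algebra.
  - by rewrite bigcup_const//; exists 0%N.
  - move=> _ _ [A1 [mA1 ->]] [A2 [mA2 ->]].
    exists (fun k => A1 k `&` A2 k); split; first by move=> k; exact: measurableI.
    apply/seteqP; split=> f /= => [[f1 f2] k|f12]; first by split.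
    by split=> k; have [] := f12 k.
  - move=> _ [B [mB ->]].
    transitivity (P (\bigcap_k g k @^-1` B k)).
      by congr (P _); apply/seteqP; split=> w fw k => [_|]; exact: fw.
    rewrite Pg// -Ph//.
    by congr (P _); apply/seteqP; split=> w fw k => [|_]; exact: fw.
  - by move=> _; rewrite ltey_eq fin_num_measure.
move=> A sA; apply: law.
move: A sA; apply: smallest_sub; first exact: smallest_sigma_algebra.
move=> _ [k _ [B mB <-]]; rewrite setTI; apply: sub_sigma_algebra.
exists (fun i => if i == k then B else setT); split; first by move=> i; case: ifP.
apply/seteqP; split=> [f Bf i|f /(_ k)]; last by rewrite eqxx.
by case: eqP => // ->.
Qed.

End law.

(** * Symmetries of the indices and of the trigonometric functions *)

Section signed.
Context d (Omega : measurableType d) (R : realType) (P : probability Omega R).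
Local Notation N := (@normal_prob R 0 1).

Lemma iid_normal_signed (I : finType) (g : I -> Omega -> R) (sigma : I -> I)
    (e : I -> bool) : involutive sigma -> iid_normal P g ->
  iid_normal P (fun k w => if e k then - g (sigma k) w else g (sigma k) w).
Proof.
move=> sigmaK [mg Pg]; split=> [k|A mA].
  by case: (e k) => //; exact: measurable_funN.
pose B j := if e (sigma j) then -%R @^-1` A (sigma j) else A (sigma j).
have mB j : measurable (B j).
  by rewrite /B; case: ifP => // _; exact: (measurable_preimageT (f := -%R : R -> R)).
rewrite (_ : \bigcap_k _ = \bigcap_k g k @^-1` B k); last first.
  apply/seteqP; split=> w fw k _.
    by have := fw (sigma k) Logic.I; rewrite /= /B sigmaK; case: ifP.
  by have := fw (sigma k) Logic.I; rewrite /= /B sigmaK; case: ifP.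
rewrite Pg// [RHS](reindex_inj (inv_inj sigmaK)); apply: eq_bigr => k _.
by rewrite /B; case: ifP => // _; exact: normal_probN.
Qed.

End signed.

Section complex_measurable.
Context {R : realType}.

Lemma measurable_Re : measurable_fun setT (@complex.Re R).
Proof.
move=> _ B mB; apply: sub_sigma_algebra; left; by exists B.
Qed.

Lemma measurable_Im : measurable_fun setT (@complex.Im R).
Proof.
move=> _ B mB; apply: sub_sigma_algebra; right; by exists B.
Qed.

Lemma measurable_complex d (T : measurableType d) (f g : T -> R) :
  measurable_fun setT f -> measurable_fun setT g ->
  measurable_fun setT (fun w => (f w +i* g w)%C).
Proof.
move=> mf mg; apply: (@measurability _ _ T R[i] setT _
  (preimage_set_system setT (@complex.Re R) measurable `|`
   preimage_set_system setT (@complex.Im R) measurable)) => //.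
by move=> _ [_ [[B mB <-]|[B mB <-]] <-]; rewrite !setTI;
  [exact: (measurable_preimageT mf)|exact: (measurable_preimageT mg)].
Qed.

End complex_measurable.

Section lattice_points.
Context (n : nat) (n0 : (0 < n)%N).

Lemma Lambda_oppK : involutive (@Lambda_opp n).
Proof. by move=> l; apply: val_inj; rewrite /= opprK. Qed.

(** The origin is not in Lambda n since n > 0. *)
Lemma Lambda_opp_neq (l : Lambda n) : Lambda_opp l != l.
Proof.
apply/eqP => /(congr1 val) /=; have := fsvalP l; rewrite in_Lambda.
case: (fsval l) => a b /= /eqP ab [ea eb].
by move: ab; rewrite !expr2; nia.
Qed.

(** A choice of one point in each pair {l, -l}; any choice would do, and comparing
    ranks gives one without case analysis on the coordinates. *)
Definition Lambda_pos (l : Lambda n) : bool :=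
  (enum_rank l < enum_rank (Lambda_opp l))%N.

Lemma Lambda_pos_opp l : Lambda_pos (Lambda_opp l) = ~~ Lambda_pos l.
Proof.
rewrite /Lambda_pos Lambda_oppK -leqNgt [RHS]leq_eqVlt.
case: eqP => //= /val_inj /enum_rank_inj /eqP.
by rewrite (negbTE (Lambda_opp_neq l)).
Qed.

End lattice_points.

Section torus_trig.
Context {R : realType}.
Implicit Types (l : int * int) (x y : torus R).

Definition torus_sin l x : R := complex.Im (torus_e l x).

Lemma torus_e_cos_sin l x : torus_e l x = (torus_cos l x +i* torus_sin l x)%C.
Proof. by []. Qed.

Lemma innerN l (z : R * R) : inner (- l) z = - inner l z.
Proof. by rewrite /inner /= !rmorphN /=; ring. Qed.

Lemma torus_cosN l x : torus_cos (- l) x = torus_cos l x.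
Proof. by rewrite /torus_cos innerN mulrN cosN. Qed.

Lemma torus_sinN l x : torus_sin (- l) x = - torus_sin l x.
Proof. by rewrite /torus_sin /torus_e /expi /= innerN mulrN sinN. Qed.

Lemma torus_cosB l x y :
  torus_cos l (x - y) = torus_cos l x * torus_cos l y + torus_sin l x * torus_sin l y.
Proof.
rewrite -[in LHS](reprK x) -[in LHS](reprK y) -raddfB torus_cosE.
rewrite /torus_sin /torus_cos /torus_e /expi /= -cosB; congr cos.
by rewrite /inner /=; ring.
Qed.

End torus_trig.

(** * The real and imaginary parts of the wave *)

Section components.
Context d (Omega : measurableType d) (R : realType) (P : probability Omega R).
Context (n : nat).
Local Notation N := (@normal_prob R 0 1).
Local Notation L := (Lambda n * bool)%type.

Definition component (v : Lambda n -> Omega -> R[i]) (p : L) (w : Omega) : R :=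
  if p.2 then complex.Im (v p.1 w) else complex.Re (v p.1 w).

Lemma gaussian_rv_std (X : Omega -> R) : gaussian_rv P X 0 1 -> std_normal P X.
Proof.
move=> [mX _ PX]; split=> // A mA.
by rewrite PX// oner_eq0 sqrtr1.
Qed.

Lemma iid_normal_component v :
  iid_standard_complex_gaussian P v -> iid_normal P (component v).
Proof.
move=> [indv _ gv].
have nRe l : std_normal P (fun w => complex.Re (v l w)).
  by apply: gaussian_rv_std; case: (gv l).
have nIm l : std_normal P (fun w => complex.Im (v l w)).
  by apply: gaussian_rv_std; case: (gv l).
split=> [[l []]|A mA]; [exact: (nIm l).1|exact: (nRe l).1|].
pose B l := (@complex.Re R @^-1` A (l, false)) `&` (@complex.Im R @^-1` A (l, true)).
have mB l : measurable (B l).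
  apply: measurableI; apply: measurable_preimageT => //.
  - exact: measurable_Re.
  - exact: measurable_Im.
rewrite (_ : \bigcap_k _ = \bigcap_(l in [set` [set: Lambda n]%SET]) (v l @^-1` B l)); last first.
  apply/seteqP; split=> w fw.
    by move=> l _; split; [exact: (fw (l, false) I)|exact: (fw (l, true) I)].
  move=> [l b] _; have [|f t] := fw l; first by rewrite /= finset.in_setT.
  by case: b.
rewrite indv// (eq_bigl predT); last by move=> l; rewrite finset.in_setT.
rewrite [RHS](eq_bigr (fun p => N (A (p.1, p.2)))); last by case.
rewrite -(pair_bigA _ (fun l b => N (A (l, b))))/=; apply: eq_bigr => l _.
rewrite big_bool/= muleC.
have [_ _ _ indl] := gv l.
rewrite -(nRe l).2// -(nIm l).2//.
by apply: indl; [exists (A (l, false))|exists (A (l, true))] => //; rewrite setTI.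
Qed.

(** The components of -i v, when g is made of those of v: the imaginary part of the
    wave of v is the real part of the wave of -i v. *)
Definition quarter_turn (g : L -> Omega -> R) (p : L) (w : Omega) : R :=
  if p.2 then - g (p.1, ~~ p.2) w else g (p.1, ~~ p.2) w.

Lemma iid_normal_quarter_turn g : iid_normal P g -> iid_normal P (quarter_turn g).
Proof.
by apply: (iid_normal_signed (sigma := fun p : L => (p.1, ~~ p.2)) snd) => -[l []].
Qed.

(** The real part of the wave whose coefficients have components g. *)
Definition real_wave (g : L -> Omega -> R) (x : torus R) (w : Omega) : R :=
  (Num.sqrt (#|` Lambda n|%:R))^-1 * \sum_(l : Lambda n)
    (g (l, false) w * torus_cos (fsval l) x - g (l, true) w * torus_sin (fsval l) x).

Lemma Re_sum (I : finType) (F : I -> R[i]) :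
  complex.Re (\sum_i F i) = \sum_i complex.Re (F i).
Proof. by apply: (big_morph (@complex.Re R)) => // -[a b] [c e]. Qed.

Lemma Im_sum (I : finType) (F : I -> R[i]) :
  complex.Im (\sum_i F i) = \sum_i complex.Im (F i).
Proof. by apply: (big_morph (@complex.Im R)) => // -[a b] [c e]. Qed.

Lemma Re_wave c x w : complex.Re (wave c x w) = real_wave (component c) x w.
Proof.
rewrite /wave /real_wave; have := @Re_sum _ (fun l : Lambda n => c l w * torus_e (fsval l) x).
case: (\sum_l _) => a b /= ->; rewrite mul0r subr0; congr (_ * _).
apply: eq_bigr => l _; rewrite /component /= torus_e_cos_sin.
by case: (c l w).
Qed.

Lemma Im_wave c x w : complex.Im (wave c x w) = real_wave (quarter_turn (component c)) x w.
Proof.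
rewrite /wave /real_wave; have := @Im_sum _ (fun l : Lambda n => c l w * torus_e (fsval l) x).
case: (\sum_l _) => a b /= ->; rewrite mul0r addr0; congr (_ * _).
apply: eq_bigr => l _; rewrite /component /quarter_turn /= torus_e_cos_sin.
by case: (c l w) => p q /=; ring.
Qed.

Definition wave_coef (x : torus R) (p : L) : R :=
  (Num.sqrt (#|` Lambda n|%:R))^-1 *
    if p.2 then - torus_sin (fsval p.1) x else torus_cos (fsval p.1) x.

Lemma sum_pair_bool (F : L -> R) :
  \sum_p F p = \sum_l (F (l, false) + F (l, true)).
Proof.
rewrite (eq_bigr (fun p => F (p.1, p.2))); last by case.
rewrite -(pair_bigA _ (fun l b => F (l, b)))/=.
by apply: eq_bigr => l _; rewrite big_bool addrC.
Qed.

Lemma real_waveE g x : real_wave g x = lincomb g (wave_coef x).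
Proof.
apply/funext => w; rewrite /real_wave /lincomb sum_pair_bool mulr_sumr.
by apply: eq_bigr => l _; rewrite /wave_coef /=; ring.
Qed.

Lemma wave_coef_dot x y : \sum_p wave_coef x p * wave_coef y p =
  (#|` Lambda n|%:R)^-1 * \sum_(l : Lambda n) torus_cos (fsval l) (x - y).
Proof.
rewrite sum_pair_bool mulr_sumr; apply: eq_bigr => l _.
rewrite torus_cosB /wave_coef /=.
rewrite -[in RHS](@sqr_sqrtr _ #|` Lambda n|%:R)// -exprVn expr2; ring.
Qed.

Lemma real_wave_gaussian g : iid_normal P g -> centered_gaussian_field P (real_wave g).
Proof.
move=> ig; split=> [k x t|x]; last by rewrite real_waveE; exact: lincomb_expectation.
exists 0; eexists.
rewrite (_ : (fun w => _) = lincomb g (fun p => \sum_(j < k) t j * wave_coef (x j) p)).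
  exact: lincomb_gaussian.
apply/funext => w; rewrite /lincomb.
under [RHS]eq_bigr do rewrite mulr_suml.
rewrite exchange_big/=; apply: eq_bigr => j _.
by rewrite real_waveE /lincomb mulr_sumr; apply: eq_bigr => p _; rewrite mulrA.
Qed.

Lemma real_wave_cov g x y : iid_normal P g ->
  ('E_P[fun w => (real_wave g x w * real_wave g y w)%R] =
   ((#|` Lambda n|%:R)^-1 * \sum_(l : Lambda n) torus_cos (fsval l) (x - y))%:E)%E.
Proof.
by move=> ig; rewrite !real_waveE lincomb_cov// wave_coef_dot.
Qed.

(** The vector (z_l + conj z_-l) / 2, where z has components f. *)
Definition hermitian (f : L -> R) (l : Lambda n) : R[i] :=
  ((f (l, false) + f (Lambda_opp l, false)) / 2 +i*
   ((f (l, true) - f (Lambda_opp l, true)) / 2))%C.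

Definition hermitian_coef (g : L -> Omega -> R) (l : Lambda n) (w : Omega) : R[i] :=
  hermitian (g ^~ w) l.

Lemma hermitian_coefC g l w :
  hermitian_coef g l w = ((hermitian_coef g (Lambda_opp l) w)^*)%C.
Proof.
by rewrite /hermitian_coef /hermitian /= Lambda_oppK; congr (_ +i* _)%C; ring.
Qed.

(** The coefficients z_l and conj z_-l contribute complex conjugate terms to the sum,
    because e_-l is the conjugate of e_l. *)
Lemma wave_hermitian g x w :
  ((real_wave g x w)%:C)%C = wave (hermitian_coef g) x w.
Proof.
have oppK := can_inj (@Lambda_oppK n).
have sumopp (F : Lambda n -> R) : \sum_l F (Lambda_opp l) = \sum_l F l.
  by rewrite [RHS](reindex_inj oppK).
pose S := \sum_(l : Lambda n) hermitian_coef g l w * torus_e (fsval l) x.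
have ReS : complex.Re S = \sum_(l : Lambda n)
    (g (l, false) w * torus_cos (fsval l) x - g (l, true) w * torus_sin (fsval l) x).
  rewrite Re_sum.
  pose F (l : Lambda n) : R := (g (l, false) w * torus_cos (fsval l) x -
               g (l, true) w * torus_sin (fsval l) x) / 2.
  rewrite (eq_bigr (fun l => F l + F (Lambda_opp l))); last first.
    by move=> l _; rewrite torus_e_cos_sin /F /= torus_cosN torus_sinN; field.
  rewrite big_split/= sumopp -big_split/=; apply: eq_bigr => l _.
  by rewrite /F; field.
have ImS : complex.Im S = 0.
  rewrite Im_sum.
  pose F (l : Lambda n) : R := (g (l, false) w * torus_sin (fsval l) x +
               g (l, true) w * torus_cos (fsval l) x) / 2.
  rewrite (eq_bigr (fun l => F l - F (Lambda_opp l))); last first.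
    by move=> l _; rewrite torus_e_cos_sin /F /= torus_cosN torus_sinN; field.
  by rewrite sumrB sumopp subrr.
rewrite /wave -/S /real_wave -ReS.
case: S ImS ReS => a b /= -> _; apply/eqP; rewrite eq_complex /=.
by rewrite !(mulr0, mul0r, subr0, addr0) !eqxx.
Qed.

End components.

(** * The law of the Hermitian coefficients *)

Section hermitian_measurability.
Context {R : realType} (n : nat).
Local Notation L := (Lambda n * bool)%type.

Lemma measurable_hermitian d (T : measurableType d) (g : L -> T -> R) l :
  (forall b, measurable_fun setT (g (l, b))) ->
  (forall b, measurable_fun setT (g (Lambda_opp l, b))) ->
  measurable_fun setT (fun w => hermitian (g ^~ w) l).
Proof.
move=> m1 m2; apply: measurable_complex; apply: measurable_funM => //.
- exact: measurable_funD.
- exact: measurable_funB.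
Qed.

Lemma measurable_real_wave d (T : measurableType d) (g : L -> T -> R) x :
  (forall p, measurable_fun setT (g p)) -> measurable_fun setT (real_wave g x).
Proof.
move=> mg; apply: measurable_funM => //; apply: measurable_sum => l.
by apply: measurable_funB; exact: measurable_funM.
Qed.

(** The Hermitian coefficients are a measurable image of the family of components. *)
Lemma same_joint_law_hermitian d (Omega : measurableType d)
    (P : probability Omega R) (g h : L -> Omega -> R) :
  same_joint_law P g h -> same_joint_law P (hermitian_coef g) (hermitian_coef h).
Proof.
move=> gh A sA; apply: (gh [set f | A (hermitian f)]).
pose G1 := \bigcup_p preimage_set_system setT (fun f : L -> R => f p) measurable.
move: A sA; apply: smallest_sub.
  have [s0 sC sU] := smallest_sigma_algebra setT G1; split.
  - exact: s0.
  - by move=> A sA; have := sC _ sA; rewrite !setTD.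
  - by move=> F sF; exact: sU.
move=> _ [l _ [B mB <-]].
have me p : @measurable_fun _ _ (g_sigma_algebraType G1) R setT (fun f => f p).
  by move=> _ C mC; apply: sub_sigma_algebra; exists p => //; exists C.
have := @measurable_hermitian _ (g_sigma_algebraType G1) (fun p f => f p) l
  (fun b => me _) (fun b => me _).
by move=> /(_ measurableT B mB); rewrite !setTI.
Qed.

End hermitian_measurability.

Section hermitian_law.
Context d (Omega : measurableType d) (R : realType) (P : probability Omega R).
Context (n : nat) (n0 : (0 < n)%N).
Local Notation L := (Lambda n * bool)%type.
Variable g : L -> Omega -> R.
Hypothesis ig : iid_normal P g.

Definition pair_opp (p : L) : L := (Lambda_opp p.1, p.2).
Definition pair_pos (p : L) : bool := Lambda_pos p.1.
Local Notation h := (symmetrized g pair_opp pair_pos).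

(** The member of {l, -l} whose sign is b. *)
Definition signed_rep (b : bool) (l : Lambda n) : Lambda n :=
  if Lambda_pos l == b then l else Lambda_opp l.

Lemma Lambda_pos_signed_rep b l : Lambda_pos (signed_rep b l) = b.
Proof.
rewrite /signed_rep; case: eqP => // /eqP.
by rewrite Lambda_pos_opp//; case: (Lambda_pos l); case: b.
Qed.

Lemma iid_normal_pair_symmetrized : iid_normal P h.
Proof.
apply: iid_normal_symmetrized => //.
- by move=> [l b]; rewrite /pair_opp /= Lambda_oppK.
- by move=> [l b]; rewrite /pair_pos /= Lambda_pos_opp.
Qed.

Let sqrt2_inv2 (x : R) : (Num.sqrt 2)^-1 * (x / Num.sqrt 2) = x / 2.
Proof. by rewrite mulrC -mulrA -invfM -expr2 sqr_sqrtr. Qed.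

(** The real part involves only the symmetrized variable of the positive member of
    {l, -l}, at the real component, and the imaginary part only that of the negative
    member, at the imaginary component. *)
Lemma hermitian_coefE l w : hermitian_coef g l w =
  (((Num.sqrt 2)^-1 * h (signed_rep true l, false) w) +i*
   ((-1) ^+ Lambda_pos l / Num.sqrt 2 * h (signed_rep false l, true) w))%C.
Proof.
rewrite -[_ / _ * _]mulrA /symmetrized /pair_pos /pair_opp /= !Lambda_pos_signed_rep !sqrt2_inv2.
rewrite /hermitian_coef /hermitian /signed_rep; case: (Lambda_pos l) => /=;
  by rewrite ?Lambda_oppK; congr (_ +i* _)%C; rewrite ?expr0 ?expr1; ring.
Qed.

Lemma hermitian_coef_quarter_turnE l w : hermitian_coef (quarter_turn g) l w =
  (((Num.sqrt 2)^-1 * h (signed_rep true l, true) w) +i*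
   (- (-1) ^+ Lambda_pos l / Num.sqrt 2 * h (signed_rep false l, false) w))%C.
Proof.
rewrite -[_ / _ * _]mulrA /symmetrized /pair_pos /pair_opp /= !Lambda_pos_signed_rep !sqrt2_inv2.
rewrite /hermitian_coef /hermitian /signed_rep /quarter_turn; case: (Lambda_pos l) => /=;
  by rewrite ?Lambda_oppK; congr (_ +i* _)%C; rewrite ?expr0 ?expr1; ring.
Qed.

Lemma hermitian_coef_gaussian l : complex_gaussian_rv P (hermitian_coef g l) (1 / 2).
Proof.
have ih := iid_normal_pair_symmetrized.
have q2 : (Num.sqrt 2)^-1 ^+ 2 = 1 / 2 :> R by rewrite exprVn sqr_sqrtr// div1r.
have ReE : (fun w => complex.Re (hermitian_coef g l w)) =
    (fun w => (Num.sqrt 2)^-1 * h (signed_rep true l, false) w).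
  by apply/funext => w; rewrite hermitian_coefE.
have ImE : (fun w => complex.Im (hermitian_coef g l w)) =
    (fun w => ((-1) ^+ Lambda_pos l / Num.sqrt 2) * h (signed_rep false l, true) w).
  by apply/funext => w; rewrite hermitian_coefE.
split.
- by apply: measurable_hermitian => b; case: ig.
- by rewrite ReE -q2; exact: (gaussian_rv_scale _ (iid_normal_std ih _)).
- rewrite ImE (_ : 1 / 2 = ((-1) ^+ Lambda_pos l / Num.sqrt 2) ^+ 2).
    exact: (gaussian_rv_scale _ (iid_normal_std ih _)).
  by rewrite exprMn sqrr_sign [RHS]mul1r q2.
- rewrite ReE ImE.
  apply: (indep_rv_cylinder ih (J := fun p => ~~ p.2) (K := fun p => p.2)) => //.
  + by apply: measurable_funM => //; exact: cylinder_measurable.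
  + by apply: measurable_funM => //; exact: cylinder_measurable.
Qed.

(** The two coefficients depend on disjoint groups of components. *)
Lemma hermitian_coef_indep_rv l s : l \notin [:: s; Lambda_opp s] ->
  indep_rv P (hermitian_coef g l) (hermitian_coef g s).
Proof.
rewrite !inE negb_or => /andP[ls los].
pose J s (p : L) := (p.1 == s) || (p.1 == Lambda_opp s).
apply: (indep_rv_cylinder ig (J := J l) (K := J s)).
- move=> [k b]; rewrite /J /= => /orP[] /eqP ->; first by rewrite (negbTE ls).
  rewrite (can2_eq (@Lambda_oppK n) (@Lambda_oppK n)) (negbTE los).
  by rewrite (inj_eq (can_inj (@Lambda_oppK n))).
- by apply: measurable_hermitian => b; apply: cylinder_measurable; rewrite /J /= eqxx ?orbT.
- by apply: measurable_hermitian => b; apply: cylinder_measurable; rewrite /J /= eqxx ?orbT.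
Qed.

(** The indices of the symmetrized variables on which the coefficients of the real
    part depend; those of the imaginary part depend on the complement. *)
Definition real_half (p : L) : bool := Lambda_pos p.1 (+) p.2.

Lemma hermitian_coef_cylinder l :
  @measurable_fun _ _ (g_sigma_algebraType (cylinder h real_half)) _ setT (hermitian_coef g l).
Proof.
rewrite (funext (hermitian_coefE l)).
apply: measurable_complex; apply: measurable_funM;
  solve [exact: measurable_cst |
    by apply: cylinder_measurable; rewrite /real_half /= Lambda_pos_signed_rep].
Qed.

Lemma hermitian_coef_quarter_turn_cylinder l :
  @measurable_fun _ _ (g_sigma_algebraType (cylinder h (fun p => ~~ real_half p))) _ setT
    (hermitian_coef (quarter_turn g) l).
Proof.
rewrite (funext (hermitian_coef_quarter_turnE l)).
apply: measurable_complex; apply: measurable_funM;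
  solve [exact: measurable_cst |
    by apply: cylinder_measurable; rewrite /real_half /= Lambda_pos_signed_rep].
Qed.

Lemma indep_hermitian_coef :
  indep_families P (hermitian_coef g) (hermitian_coef (quarter_turn g)).
Proof.
apply: (indep_families_cylinder iid_normal_pair_symmetrized
  (J := real_half) (K := fun p => ~~ real_half p)).
- by move=> p; rewrite negbK.
- exact: hermitian_coef_cylinder.
- exact: hermitian_coef_quarter_turn_cylinder.
Qed.

Lemma real_wave_hermitian (f : L -> Omega -> R) x :
  real_wave f x = real_wave (component (hermitian_coef f)) x.
Proof. by apply/funext => w; rewrite -Re_wave -wave_hermitian. Qed.

Lemma measurable_component d' (T : measurableType d') (c : Lambda n -> T -> R[i]) p :
  (forall l, measurable_fun setT (c l)) -> measurable_fun setT (component c p).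
Proof.
by case: p => l [] mc; apply: measurableT_comp => //; [exact: measurable_Im|exact: measurable_Re].
Qed.

(** The waves are functions of their Hermitian coefficients, so they live on
    complementary halves of the symmetrized variables. *)
Lemma indep_real_wave : indep_families P (real_wave g) (real_wave (quarter_turn g)).
Proof.
apply: (indep_families_cylinder iid_normal_pair_symmetrized
  (J := real_half) (K := fun p => ~~ real_half p)).
- by move=> p; rewrite negbK.
- move=> x; rewrite real_wave_hermitian; apply: measurable_real_wave => p.
  by apply: measurable_component; exact: hermitian_coef_cylinder.
- move=> x; rewrite real_wave_hermitian; apply: measurable_real_wave => p.
  by apply: measurable_component; exact: hermitian_coef_quarter_turn_cylinder.
Qed.

End hermitian_law.

Theorem proposition1p4 (d : measure_display) (Omega : measurableType d)
    (R : realType) (P : probability Omega R) (n : nat)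
    (v : Lambda n -> Omega -> R[i]) :
  sum_two_squares n -> iid_standard_complex_gaussian P v ->
  let T (x : torus R) (w : Omega) : R := complex.Re (wave v x w) in
  let That (x : torus R) (w : Omega) : R := complex.Im (wave v x w) in
  [/\ centered_gaussian_field P T,
      centered_gaussian_field P That,
      indep_families P T That,
      forall x y : torus R,
        let r := (#|` Lambda n|%:R)^-1 *
                 \sum_(l : Lambda n) torus_cos (fsval l) (x - y) in
        ('E_P[fun w => (T x w * T y w)%R] = r%:E)%E /\
        ('E_P[fun w => (That x w * That y w)%R] = r%:E)%E &
      exists a ahat : Lambda n -> Omega -> R[i],
        [/\ (forall l, measurable_fun setT (a l) /\
                       measurable_fun setT (ahat l)),
            indep_families P a ahat /\ same_joint_law P a ahat,
            (forall l, complex_gaussian_rv P (a l) (1 / 2)),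
            (forall l s, l \notin [:: s; Lambda_opp s] ->
               indep_rv P (a l) (a s)) &
            (forall l w, a l w = ((a (Lambda_opp l) w)^*)%C) /\
            (forall x w, ((T x w)%:C)%C = wave a x w /\
                         ((That x w)%:C)%C = wave ahat x w)]].
Proof.
move=> [n0 _] iv T That.
have ig := iid_normal_component iv; have ig' := iid_normal_quarter_turn ig.
have TE : T = real_wave (component v).
  by apply/funext => x; apply/funext => w; exact: Re_wave.
have ThatE : That = real_wave (quarter_turn (component v)).
  by apply/funext => x; apply/funext => w; exact: Im_wave.
rewrite TE ThatE; split.
- exact: real_wave_gaussian.
- exact: real_wave_gaussian.
- exact: indep_real_wave.
- by move=> x y r; rewrite !real_wave_cov.
exists (hermitian_coef (component v)), (hermitian_coef (quarter_turn (component v))); split.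
- by move=> l; split; apply: measurable_hermitian => b; [case: ig|case: ig|case: ig'|case: ig'].
- split; first exact: indep_hermitian_coef.
  by apply: same_joint_law_hermitian; exact: iid_normal_same_joint_law.
- by move=> l; exact: hermitian_coef_gaussian.
- by move=> l s; exact: hermitian_coef_indep_rv.
- by split=> [l w|x w]; [exact: hermitian_coefC|split; exact: wave_hermitian].
Qed.
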